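(* Let $Q(\lambda,\mu)=\lambda^2A_{20}+\mu^2A_{02}+\lambda\mu A_{11}+\lambda A_{10}+\mu A_{01}+A_{00}$ be a quadratic two-parameter matrix polynomial with coefficient matrices $A_{ij}\in\mathbb{C}^{n\times n}$, and let $v\in\mathbb{C}^3$. Then the linear two-parameter matrix polynomials $L(\lambda,\mu)\in\mathbb{L}(Q(\lambda,\mu))$ corresponding to the ansatz vector $v$ are exactly those of the form $L(\lambda,\mu)=\lambda\widehat{A}_1+\mu\widehat{A}_2+\widehat{A}_3$ with $$\widehat{A}_1=\begin{bmatrix}v\otimes A_{20} & -Y_1+v\otimes A_{11} & -Z_1+v\otimes A_{10}\end{bmatrix},$$ $$\widehat{A}_2=\begin{bmatrix}Y_1 & v\otimes A_{02} & -Z_2+v\otimes A_{01}\end{bmatrix},$$ $$\widehat{A}_3=\begin{bmatrix}Z_1 & Z_2 & v\otimes A_{00}\end{bmatrix},$$ where $Y_1,Z_1,Z_2\in\mathbb{C}^{3n\times n}$ are arbitrary.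
   Context: Here $\otimes$ is the Kronecker product, $I_n$ is the $n\times n$ identity matrix, and $\Lambda=\begin{bmatrix}\lambda\\ \mu\\ 1\end{bmatrix}$. Let $\mathcal{V}_Q=\{v\otimes Q(\lambda,\mu): v\in\mathbb{C}^3\}$ and $$\mathbb{L}(Q(\lambda,\mu))=\left\{L(\lambda,\mu)=\lambda\widehat{A}_1+\mu\widehat{A}_2+\widehat{A}_3,\ \widehat{A}_i\in\mathbb{C}^{3n\times 3n}\ :\ L(\lambda,\mu)\cdot(\Lambda\otimes I_n)\in\mathcal{V}_Q\right\},$$ where membership in $\mathcal{V}_Q$ is as matrix polynomials in $\lambda,\mu$. One says that $L(\lambda,\mu)\in\mathbb{L}(Q(\lambda,\mu))$ corresponds to the ansatz vector $v\in\mathbb{C}^3$ if $L(\lambda,\mu)\cdot(\Lambda\otimes I_n)=v\otimes Q(\lambda,\mu)$ identically in $\lambda,\mu$. The matrices $\widehat{A}_i$ are written as block rows of three $3n\times n$ blocks. *)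

(* Defs.v *)
From mathcomp Require Import all_boot all_order all_algebra.
From mathcomp Require Import reals.
From mathcomp Require Import complex mxtens mpoly.

Set Implicit Arguments.
Unset Strict Implicit.
Unset Printing Implicit Defensive.

Import GRing.Theory.
Local Open Scope ring_scope.

(* The product of a column vector with an n-column matrix by [tensmx] has
   [1 * n] columns, which is not convertible to [n]; hence the cast. *)
Definition kron_col (K : pzRingType) (p m n : nat)
    (v : 'cV[K]_p) (M : 'M[K]_(m, n)) : 'M[K]_(p * m, n) :=
  castmx (erefl (p * m)%N, mul1n n) (tensmx v M).

Lemma three_blocks (n : nat) : (n + (n + n) = 3 * n)%N.
Proof. by rewrite !mulSn mul0n addn0. Qed.

Definition block_row3 (K : Type) (m n : nat) (X Y Z : 'M[K]_(m, n)) :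
    'M[K]_(m, 3 * n) :=
  castmx (erefl m, three_blocks n) (row_mx X (row_mx Y Z)).

Section TwoParameter.

Variable K : comNzRingType.

(* Matrix polynomials in (lambda, mu) are matrices over K[lambda, mu], so
   equality of such matrices is identity as polynomials. *)
Definition lambda : {mpoly K[2]} := 'X_(@ord0 1).
Definition mu : {mpoly K[2]} := 'X_(@ord_max 1).

Definition const_poly_mx (m n : nat) (M : 'M[K]_(m, n)) :
    'M[{mpoly K[2]}]_(m, n) :=
  map_mx (@mpolyC 2 K) M.

Definition Lambda : 'cV[{mpoly K[2]}]_3 :=
  \col_(i < 3) [:: lambda; mu; 1]`_i.

Definition quadratic (n : nat) (A20 A02 A11 A10 A01 A00 : 'M[K]_n) :
    'M[{mpoly K[2]}]_n :=
  (lambda ^+ 2) *: const_poly_mx A20 + (mu ^+ 2) *: const_poly_mx A02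
  + (lambda * mu) *: const_poly_mx A11
  + lambda *: const_poly_mx A10 + mu *: const_poly_mx A01 + const_poly_mx A00.

Definition linear_pencil (m : nat) (A1 A2 A3 : 'M[K]_m) :
    'M[{mpoly K[2]}]_m :=
  lambda *: const_poly_mx A1 + mu *: const_poly_mx A2 + const_poly_mx A3.

Definition in_VQ (n : nat) (Q : 'M[{mpoly K[2]}]_n)
    (W : 'M[{mpoly K[2]}]_(3 * n, n)) : Prop :=
  exists v : 'cV[K]_3, W = kron_col (const_poly_mx v) Q.

Definition in_LQ (n : nat) (Q : 'M[{mpoly K[2]}]_n)
    (L : 'M[{mpoly K[2]}]_(3 * n)) : Prop :=
  (exists A1 A2 A3 : 'M[K]_(3 * n), L = linear_pencil A1 A2 A3)
  /\ in_VQ Q (L *m kron_col Lambda 1%:M).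

Definition has_ansatz_vector (n : nat) (Q : 'M[{mpoly K[2]}]_n)
    (L : 'M[{mpoly K[2]}]_(3 * n)) (v : 'cV[K]_3) : Prop :=
  L *m kron_col Lambda 1%:M = kron_col (const_poly_mx v) Q.

End TwoParameter.

(* Main.v *)
Require Import Defs.
From mathcomp Require Import all_boot all_order all_algebra.
From mathcomp Require Import reals.
From mathcomp Require Import complex mxtens mpoly.
From mathcomp Require Import ring.

Import GRing.Theory.
Local Open Scope ring_scope.
Local Open Scope complex_scope.

(** Splitting each coefficient of the pencil into three column blocks, the
    product with [Lambda (x) I_n] is a quadratic polynomial whose coefficients
    are sums of at most two of these blocks; comparing them with those of
    [v (x) Q] determines three blocks and leaves one free block in each of the
    three remaining equations. *)

Lemma kron_colE (K : pzRingType) (p m n : nat) (v : 'cV[K]_p) (M : 'M[K]_(m, n))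
    (i : 'I_p) (j : 'I_m) (k : 'I_n) :
  kron_col v M (mxtens_index (i, j)) k = v i 0 * M j k.
Proof.
rewrite /kron_col castmxE /= -(tensmxE v M).
(* The cast column [k] and the tensor column with index pair [(0, k)] are both the natural number
   [k], so comparing values suffices. *)
by congr (tensmx v M _ _); apply: val_inj.
Qed.

Lemma map_kron_col (K S : pzRingType) (f : {rmorphism K -> S}) (p m n : nat)
    (v : 'cV[K]_p) (M : 'M[K]_(m, n)) :
  map_mx f (kron_col v M) = kron_col (map_mx f v) (map_mx f M).
Proof. by rewrite /kron_col map_castmx map_mxT. Qed.

Lemma kron_colD (K : pzRingType) (p m n : nat) (v : 'cV[K]_p)
    (M N : 'M[K]_(m, n)) :
  kron_col v (M + N) = kron_col v M + kron_col v N.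
Proof.
apply/matrixP=> r k; case: (mxtens_indexP r) => i j.
by rewrite [RHS]mxE !kron_colE mxE mulrDr.
Qed.

Lemma kron_colZ (K : comPzRingType) (p m n : nat) (v : 'cV[K]_p) (a : K)
    (M : 'M[K]_(m, n)) :
  kron_col v (a *: M) = a *: kron_col v M.
Proof.
apply/matrixP=> r k; case: (mxtens_indexP r) => i j.
by rewrite [RHS]mxE !kron_colE mxE mulrCA.
Qed.

Lemma block_row3_surj (K : Type) (m n : nat) (A : 'M[K]_(m, 3 * n)) :
  exists X Y Z : 'M[K]_(m, n), A = block_row3 X Y Z.
Proof.
set B := castmx (erefl m, esym (three_blocks n)) A.
exists (lsubmx B), (lsubmx (rsubmx B)), (rsubmx (rsubmx B)).
by rewrite /block_row3 !hsubmxK castmx_comp castmx_id.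
Qed.

Lemma map_block_row3 (K S : Type) (f : K -> S) (m n : nat)
    (X Y Z : 'M[K]_(m, n)) :
  map_mx f (block_row3 X Y Z)
  = block_row3 (map_mx f X) (map_mx f Y) (map_mx f Z).
Proof. by rewrite /block_row3 map_castmx !map_row_mx. Qed.

(** Row [mxtens_index (i, j)] sits at position [i * n + j]: thus [i] selects one of three stacked
    scalar blocks and [j] the row inside it. In this form the product with a block row is ordinary
    block multiplication. *)
Lemma kron_col_Lambda (K : comNzRingType) (n : nat) :
  kron_col (Lambda K) 1%:M
  = castmx (three_blocks n, erefl n)
      (col_mx (lambda K)%:M (col_mx (mu K)%:M 1%:M)).
Proof.
apply/matrixP=> r k; case: (mxtens_indexP r) => i j.
rewrite kron_colE castmxE cast_ord_id /Lambda mxE.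
case: i => [[|[|[|//]]] lti] /=.
- have -> : cast_ord (esym (three_blocks n)) (mxtens_index (Ordinal lti, j))
    = lshift (n + n) j by apply: val_inj.
  by rewrite col_mxEu !mxE mulr_natr.
- have -> : cast_ord (esym (three_blocks n)) (mxtens_index (Ordinal lti, j))
    = rshift n (lshift n j) by apply: val_inj; rewrite /= mul1n.
  by rewrite col_mxEd col_mxEu !mxE mulr_natr.
- have -> : cast_ord (esym (three_blocks n)) (mxtens_index (Ordinal lti, j))
    = rshift n (rshift n j) by apply: val_inj; rewrite /= mulSn mul1n addnA.
  by rewrite !col_mxEd mul1r.
Qed.

Lemma mul_block_row3_Lambda (K : comNzRingType) (m n : nat)
    (X Y Z : 'M[{mpoly K[2]}]_(m, n)) :
  block_row3 X Y Z *m kron_col (Lambda K) 1%:M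
  = lambda K *: X + mu K *: Y + Z.
Proof.
rewrite kron_col_Lambda /block_row3 mulmx_cast castmx_comp castmx_id !mul_row_col.
by rewrite !mul_mx_scalar scale1r addrA.
Qed.

(** A rectangular version of [quadratic]: both sides of the ansatz equation have coefficients of
    size [3 * n] by [n], and both are brought to this common form. *)
Definition quadratic_mx {K : comNzRingType} {m n : nat}
    (A20 A02 A11 A10 A01 A00 : 'M[K]_(m, n)) : 'M[{mpoly K[2]}]_(m, n) :=
  (lambda K ^+ 2) *: const_poly_mx A20 + (mu K ^+ 2) *: const_poly_mx A02
  + (lambda K * mu K) *: const_poly_mx A11
  + lambda K *: const_poly_mx A10 + mu K *: const_poly_mx A01
  + const_poly_mx A00.

Lemma kron_col_quadratic (K : comNzRingType) (p n : nat) (v : 'cV[K]_p)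
    (A20 A02 A11 A10 A01 A00 : 'M[K]_n) :
  kron_col (const_poly_mx v) (quadratic A20 A02 A11 A10 A01 A00)
  = quadratic_mx (kron_col v A20) (kron_col v A02) (kron_col v A11)
      (kron_col v A10) (kron_col v A01) (kron_col v A00).
Proof.
rewrite /quadratic_mx /const_poly_mx !map_kron_col.
by rewrite !kron_colD !kron_colZ.
Qed.

(** Each mixed or linear monomial arises twice, for instance [lambda * mu] as [lambda] times the
    second block of the first coefficient and as [mu] times the first block of the second. These
    three sums are the source of the free blocks. *)
Lemma mul_pencil_Lambda (K : comNzRingType) (n : nat)
    (X1 X2 X3 Y1 Y2 Y3 Z1 Z2 Z3 : 'M[K]_(3 * n, n)) :
  linear_pencil (block_row3 X1 Y1 Z1) (block_row3 X2 Y2 Z2)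
    (block_row3 X3 Y3 Z3) *m kron_col (Lambda K) 1%:M
  = quadratic_mx X1 Y2 (X2 + Y1) (X3 + Z1) (Y3 + Z2) Z3.
Proof.
rewrite /linear_pencil /quadratic_mx /const_poly_mx !map_block_row3.
rewrite !mulmxDl -!scalemxAl !mul_block_row3_Lambda.
apply/matrixP=> i j; rewrite !mxE !mpolyCD; ring.
Qed.

Definition bidegree (a b : nat) : 'X_{1..2} :=
  (U_(@ord0 1) *+ a + U_(@ord_max 1) *+ b)%MM.

Lemma mcoeff_lambda_mu (K : comNzRingType) (a b c d : nat) :
  (lambda K ^+ c * mu K ^+ d)@_(bidegree a b) = ((c == a) && (d == b))%:R.
Proof.
rewrite /lambda /mu !mpolyXn -mpolyXD mcoeffX; congr (nat_of_bool _)%:R.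
(* Equal exponents agree at both variables, which gives the two equalities separately. *)
apply/eqP/andP => [/mnmP eqe | [/eqP -> /eqP ->] //].
have := eqe ord0; have := eqe ord_max.
by rewrite /bidegree !mnmDE !mulmnE !mnm1E /= !mul0n !mul1n !addn0 !add0n => -> ->.
Qed.

Lemma mcoeff_quadratic_mx (K : comNzRingType) (m n : nat)
    (A20 A02 A11 A10 A01 A00 : 'M[K]_(m, n)) (i : 'I_m) (j : 'I_n) (a b : nat) :
  (quadratic_mx A20 A02 A11 A10 A01 A00 i j)@_(bidegree a b)
  = ((2 == a) && (0 == b))%N%:R * A20 i j
    + ((0 == a) && (2 == b))%N%:R * A02 i j
    + ((1 == a) && (1 == b))%N%:R * A11 i j
    + ((1 == a) && (0 == b))%N%:R * A10 i j
    + ((0 == a) && (1 == b))%N%:R * A01 i j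
    + ((0 == a) && (0 == b))%N%:R * A00 i j.
Proof.
(* The indicators are turned back into coefficients of monomials, so that both sides can be compared
   term by term. *)
rewrite -!mcoeff_lambda_mu !expr0 !expr1 !mulr1 !mul1r !mxE !mcoeffD.
rewrite ![_ * _%:MP_[_]]mulrC !mcoeffCM ![_ * _@_(bidegree a b)]mulrC.
by rewrite mcoeffC mcoeff1 [A00 i j * _]mulrC.
Qed.

(** The six monomials have distinct bidegrees, so extracting the coefficient at each one leaves a
    single matrix entry on either side. *)
Lemma quadratic_mx_inj (K : comNzRingType) (m n : nat)
    (A20 A02 A11 A10 A01 A00 B20 B02 B11 B10 B01 B00 : 'M[K]_(m, n)) :
  quadratic_mx A20 A02 A11 A10 A01 A00 = quadratic_mx B20 B02 B11 B10 B01 B00 ->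
  [/\ A20 = B20, A02 = B02 & A11 = B11] /\ [/\ A10 = B10, A01 = B01 & A00 = B00].
Proof.
move=> eqAB.
have coef_eq a b i j := congr1 (fun M : 'M_(m, n) =>
  (M i j)@_(bidegree a b)) eqAB.
pose mulE := (mcoeff_quadratic_mx, mul0r, mul1r, addr0, add0r).
split; split; apply/matrixP=> i j.
- by have := coef_eq 2 0 i j; rewrite /= !mulE.
- by have := coef_eq 0 2 i j; rewrite /= !mulE.
- by have := coef_eq 1 1 i j; rewrite /= !mulE.
- by have := coef_eq 1 0 i j; rewrite /= !mulE.
- by have := coef_eq 0 1 i j; rewrite /= !mulE.
- by have := coef_eq 0 0 i j; rewrite /= !mulE.
Qed.

Theorem theorem2p5 (R : realType) (n : nat)
    (A20 A02 A11 A10 A01 A00 : 'M[R[i]]_n) (v : 'cV[R[i]]_3)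
    (L : 'M[{mpoly R[i][2]}]_(3 * n)) :
  let Q := quadratic A20 A02 A11 A10 A01 A00 in
  (in_LQ Q L /\ has_ansatz_vector Q L v) <->
  exists Y1 Z1 Z2 : 'M[R[i]]_(3 * n, n),
    L = linear_pencil
          (block_row3 (kron_col v A20)
                      (- Y1 + kron_col v A11)
                      (- Z1 + kron_col v A10))
          (block_row3 Y1
                      (kron_col v A02)
                      (- Z2 + kron_col v A01))
          (block_row3 Z1
                      Z2
                      (kron_col v A00)).
Proof.
move=> Q; split.
  case=> [[[A1 [A2 [A3 ->]]] _]].
  have [X1 [Y1 [Z1 ->]]] := block_row3_surj _ _ _ A1.
  have [X2 [Y2 [Z2 ->]]] := block_row3_surj _ _ _ A2.
  have [X3 [Y3 [Z3 ->]]] := block_row3_surj _ _ _ A3.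
  rewrite /has_ansatz_vector mul_pencil_Lambda kron_col_quadratic.
  (* The sum equations are used from right to left: [kron_col v A11] becomes [X2 + Y1], so that
     [- X2 + kron_col v A11] collapses to [Y1], and likewise for the other two. The blocks [X2],
     [X3], [Y3] remain free and serve as witnesses. *)
  case/quadratic_mx_inj=> -[-> -> <-] [<- <- ->].
  by exists X2, X3, Y3; rewrite !addKr.
case=> [Y1 [Z1 [Z2 ->]]].
set L0 := linear_pencil _ _ _.
have ansatzL : has_ansatz_vector Q L0 v.
  by rewrite /has_ansatz_vector mul_pencil_Lambda kron_col_quadratic !addNKr.
(* Membership in the space of [Q] follows from the ansatz equation itself, with [v] as the
   witness. *)
split=> //; split; last by exists v.
by do 3!eexists.
Qed.
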